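(* Let $\Delta$ be a pure (finite) simplicial complex with face poset $P$, and let $k\ge 0$ be an integer. Then $$\sum_{\substack{T\in\Delta\\ |T|=k}}\tilde\chi(\operatorname{lk}_\Delta(T))=\chi(\mathcal{O}(P_{>k}))-\chi(\mathcal{O}(P_{>k-1})).$$
   Context: Simplicial complexes are finite, contain the empty face $\varnothing$, and contain $\{v\}$ for every vertex $v$; pure means all facets have the same cardinality. The link of $T\in\Delta$ is $\operatorname{lk}_\Delta(T)=\{G\in\Delta : T\cup G\in\Delta,\ T\cap G=\varnothing\}$. $\chi(\Gamma)=\sum_{i\ge 0}(-1)^i f_i(\Gamma)$ is the Euler characteristic and $\tilde\chi(\Gamma)=\chi(\Gamma)-1$ the reduced Euler characteristic, where $f_i(\Gamma)$ is the number of $i$-dimensional faces; in particular $\chi(\{\varnothing\})=0$ and $\tilde\chi(\{\varnothing\})=-1$. The face poset of $\Delta$ is ordered by inclusion, with the height of a face equal to its cardinality, so $P_{>j}=\{\sigma\in\Delta : |\sigma|>j\}$ for every integer $j\ge -1$ (the empty face belongs to $P_{>j}$ only when $j=-1$). The order complex $\mathcal{O}(Q)$ of a finite poset $Q$ is the simplicial complex on $Q$ whose faces are the chains of $Q$ (including the empty chain). *)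

(* Defs.v *)
From HB Require Import structures.
From mathcomp Require Import all_boot all_order all_algebra.

Set Implicit Arguments.
Unset Strict Implicit.
Unset Printing Implicit Defensive.

Import Order.TTheory GRing.Theory Num.Theory.
(* {set V} is ordered by inclusion. *)
Import Order.DefaultSetSubsetOrder.
Local Open Scope ring_scope.

(* D is the set of faces. The vertex set W may be smaller than the type V, so *)
(* that links and order complexes of subposets are complexes as well.         *)
Record simplicial_complex (V : finType) (W : {set V}) (D : {set {set V}}) :
    Prop := SimplicialComplex {
  face_sub : forall F, F \in D -> F \subset W;
  face0 : set0 \in D;
  face1 : forall v, v \in W -> [set v] \in D;
  faceS : forall F G : {set V}, G \subset F -> F \in D -> G \in D
}.

Definition facets (V : finType) (D : {set {set V}}) : {set {set V}} :=
  [set F | maxset (fun G => G \in D) F].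

Definition pure (V : finType) (D : {set {set V}}) : Prop :=
  forall F G, F \in facets D -> G \in facets D -> #|F| = #|G|.

Definition link (V : finType) (D : {set {set V}}) (T : {set V}) :
    {set {set V}} :=
  [set G in D | (T :|: G \in D) && (T :&: G == set0)].

(* Faces of dimension i have i + 1 vertices. *)
Definition fnum (V : finType) (D : {set {set V}}) (i : nat) : nat :=
  #|[set F in D | #|F| == i.+1]|.

(* The sum over all i >= 0 stops at #|V|, since fnum D i = 0 for i >= #|V|. *)
Definition euler (V : finType) (D : {set {set V}}) : int :=
  \sum_(i < #|V|) (-1) ^+ i * (fnum D i)%:Z.

Definition reduced_euler (V : finType) (D : {set {set V}}) : int :=
  euler D - 1.

(* The subset P_{>j} of the face poset P of D. *)
Definition poset_gt (V : finType) (D : {set {set V}}) (j : int) :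
    {set {set V}} :=
  [set s in D | j < #|s|%:Z].

Definition order_complex (d : Order.disp_t) (T : finPOrderType d)
    (Q : {set T}) : {set {set T}} :=
  [set C : {set T} |
    (C \subset Q) && [forall x in C, forall y in C, (x >=< y)%O]].

Lemma fnum_ge (V : finType) (D : {set {set V}}) i :
  (#|V| <= i)%N -> fnum D i = 0%N.
Proof.
move=> le_i; apply/eqP; rewrite cards_eq0; apply/eqP/setP => F; rewrite !inE.
apply/negbTE/nandP; right; rewrite neq_ltn ltnS.
by rewrite (leq_trans (max_card _) le_i).
Qed.

Lemma link_complex (V : finType) (W : {set V}) (D : {set {set V}}) T :
  simplicial_complex W D -> T \in D ->
  simplicial_complex (cover (link D T)) (link D T).
Proof.
move=> [_ D0 _ DS] DT.
have lkS (F G : {set V}) : G \subset F -> F \in link D T -> G \in link D T.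
  move=> GF; rewrite !inE => /and3P[FD TFD /eqP TF0].
  rewrite (DS _ _ GF FD) (DS _ _ (setUS T GF) TFD) /=.
  by rewrite -subset0 -TF0 setIS.
split=> //; first by move=> F; apply: bigcup_sup.
- by rewrite inE D0 setU0 DT setI0 eqxx.
- move=> v /bigcupP[F FL vF]; apply: lkS FL.
  by rewrite sub1set.
Qed.

Lemma order_complex_complex (d : Order.disp_t) (T : finPOrderType d)
  (Q : {set T}) : simplicial_complex Q (order_complex Q).
Proof.
split.
- by move=> F; rewrite inE => /andP[].
- rewrite inE sub0set; apply/forall_inP => x; by rewrite inE.
- move=> v vQ; rewrite inE sub1set vQ.
  apply/forall_inP => x /set1P->; apply/forall_inP => y /set1P->.
  exact: comparablexx.
- move=> F G GF; rewrite !inE => /andP[FQ /forall_inP cF].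
  rewrite (subset_trans GF FQ); apply/forall_inP => x /(subsetP GF) /cF.
  move=> /forall_inP cx; apply/forall_inP => y /(subsetP GF); exact: cx.
Qed.

Lemma leEface (V : finType) (s t : {set V}) : (s <= t)%O = (s \subset t).
Proof. by []. Qed.

(* Main.v *)
Require Import Defs.
From mathcomp Require Import all_boot all_order all_algebra.
From mathcomp Require Import zify ring.

Set Implicit Arguments.
Unset Strict Implicit.
Unset Printing Implicit Defensive.

Import Order.TTheory GRing.Theory Num.Theory.
Import Order.DefaultSetSubsetOrder.
Local Open Scope ring_scope.

(** Write [X(D)] for the sum of [(-1)^|F|] over the faces [F] of [D], so that
the reduced Euler characteristic of a complex is [- X(D)].  Chains of
[P_{>k-1}] that are not chains of [P_{>k}] contain exactly one face [T] of
cardinality [k], and what remains is a chain of faces strictly containing [T];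
hence passing from [P_{>k}] to [P_{>k-1}] changes [X] of the order complex by
[- sum_T X(O(P_{>T}))].  Finally [X(O(P_{>T})) = X(link T)], the invariance of
the Euler characteristic under barycentric subdivision; this follows by
removing the faces of [P_{>T}] one at a time, largest first, since the
interval [[T, F]] of a Boolean lattice has vanishing alternating sum. *)

Definition alt_sum (V : finType) (D : {set {set V}}) : int :=
  \sum_(F in D) (-1) ^+ #|F|.

(** The empty face accounts for the [- 1]; for every other face, passing from dimension to
    cardinality reverses the sign. *)
Lemma reduced_eulerE (V : finType) (D : {set {set V}}) :
  set0 \in D -> reduced_euler D = - alt_sum D.
Proof.
move=> D0; rewrite /reduced_euler /euler /alt_sum.
rewrite (bigD1 set0) //= cards0 expr0 opprD addrC; congr (_ + _).
(* Each nonempty face occurs for the single index [#|F|.-1], so exchanging the two sums leaves one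
   term per face. *)
rewrite (eq_bigr (fun i : 'I_#|V| =>
    \sum_(F in D | (F != set0) && (#|F|.-1 == i)) - (-1) ^+ #|F|)).
  rewrite -sumrN [RHS](eq_bigl (fun F => (F \in D) && (F != set0))) //.
  under eq_bigr do under eq_bigl do rewrite andbA.
  rewrite (exchange_big_dep (fun F => (F \in D) && (F != set0))) /=; last first.
    by move=> i F _ /andP[].
  apply: eq_bigr => F /andP[DF F0].
  have ltF : (#|F|.-1 < #|V|)%N.
    by rewrite prednK ?card_gt0 // max_card.
  rewrite (big_pred1 (Ordinal ltF)) // => i /=.
  by rewrite DF F0 eq_sym -val_eqE.
move=> i _; rewrite /fnum -sum1dep_card -natz natr_sum mulr_sumr.
apply: eq_big => [F|F].
  by rewrite -card_gt0; case: (#|F|) => [|n] /=; rewrite ?andbF ?eqSS.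
by case/andP=> _ /eqP->; rewrite exprS mulN1r opprK mulr1.
Qed.

Section OrderComplex.
Variables (d : Order.disp_t) (T : finPOrderType d).
Implicit Types (Q S C : {set T}) (x y : T).

Lemma order_complexP Q C :
  reflect (C \subset Q /\ {in C &, forall x y, (x >=< y)%O})
          (C \in order_complex Q).
Proof.
rewrite inE; apply: (iffP andP) => -[CQ cC]; split=> //.
  by move=> x y xC yC; move/forall_inP/(_ x xC)/forall_inP: cC; apply.
by apply/forall_inP => x xC; apply/forall_inP => y; apply: cC.
Qed.

Lemma alt_sum_order_complex0 : alt_sum (order_complex (set0 : {set T})) = 1.
Proof.
rewrite /alt_sum (big_pred1 set0) ?cards0 // => C /=.
apply/order_complexP/eqP => [[]|->]; first by rewrite subset0 => /eqP.
by split; rewrite ?sub0set // => x y; rewrite inE.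
Qed.

(** Split the chains by whether they contain [x]. Deleting [x] from a chain through it leaves an
    arbitrary chain of elements comparable to [x], with the opposite sign. *)
Lemma alt_sum_order_complexD1 Q x : x \in Q ->
  alt_sum (order_complex Q) =
  alt_sum (order_complex (Q :\ x)) -
  alt_sum (order_complex [set y in Q :\ x | (x >=< y)%O]).
Proof.
move=> xQ; rewrite /alt_sum (bigID (fun C : {set T} => x \in C)) /= addrC.
congr (_ + _).
  apply: eq_bigl => C; apply/andP/order_complexP.
    by case=> /order_complexP[CQ cC] xC; rewrite subsetD1 CQ.
  case; rewrite subsetD1 => /andP[CQ xC] cC; split=> //.
  exact/order_complexP.
(* The reindexing condition [(x |: C) :\ x = C] encodes [x \notin C]. *)
rewrite -sumrN (reindex_onto (fun C => x |: C) (fun C => C :\ x)) /=; last first.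
  by move=> C /andP[_ xC]; rewrite setD1K.
apply: eq_big => [C|C].
  rewrite setU11 andbT; apply/andP/order_complexP.
    case=> /order_complexP[CQ cC] /eqP eC; have xC : x \notin C.
      by rewrite -eC !inE eqxx.
    split=> [|y z yC zC]; last by apply: cC; rewrite !inE ?yC ?zC orbT.
    apply/subsetP => y yC; have yU : y \in x |: C by rewrite inE yC orbT.
    rewrite !inE (subsetP CQ) // cC ?setU11 // !andbT.
    by apply: contraNneq xC => <-.
  case=> CQ cC; have cx y : y \in C -> [/\ y != x, y \in Q & (x >=< y)%O].
    by move/(subsetP CQ); rewrite !inE => /andP[/andP[]].
  split; last first.
    by rewrite setU1K //; apply/negP => /cx[]; rewrite eqxx.
  apply/order_complexP; split.
    by apply/subsetP => y /setU1P[->//|/cx[]].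
  move=> y z /setU1P[->|yC] /setU1P[->|zC]; first exact: comparablexx.
  - by case: (cx _ zC).
  - by rewrite comparable_sym; case: (cx _ yC).
  - exact: cC.
case/andP=> _ /eqP eC.
by rewrite cardsU1 -{1}eC !inE eqxx exprS mulN1r.
Qed.

(** Remove the elements of [S] one by one. As [S] is an antichain, the other elements comparable to
    the removed one all lie in [Q], so the order of removal does not matter. *)
Lemma alt_sum_order_complexU Q S : [disjoint Q & S] ->
  {in S &, forall x y, (x >=< y)%O -> x = y} ->
  alt_sum (order_complex (Q :|: S)) =
  alt_sum (order_complex Q) -
  \sum_(x in S) alt_sum (order_complex [set y in Q | (x >=< y)%O]).
Proof.
have [n] := ubnP #|S|; elim: n S => // n IHn S ltSn dQS aS.
have [->|[x xS]] := set_0Vmem S; first by rewrite setU0 big_set0 subr0.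
have xQ : x \notin Q by apply: contraL xS => xQ; rewrite (disjointFr dQS).
have QS1 : (Q :|: S) :\ x = Q :|: S :\ x.
  apply/setP => y; rewrite !inE; case: eqVneq => // -> /=.
  by rewrite (negPf xQ).
rewrite (@alt_sum_order_complexD1 _ x) ?inE ?xS ?orbT // QS1 IHn; first last.
- by move=> y z /setD1P[_ yS] /setD1P[_ zS]; apply: aS.
- exact: disjointWr (subsetDl _ _) dQS.
- by rewrite (cardsD1 x) xS in ltSn.
rewrite [in RHS](big_setD1 x xS) /= opprD [- _ - _]addrC addrA.
congr (_ - alt_sum (order_complex _)); apply/setP => y; rewrite !inE.
case: (boolP (x >=< y)%O) => [xy|]; rewrite ?andbF // !andbT.
case: (boolP (y \in S)) => [yS|]; last by rewrite andbF orbF.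
by rewrite -(aS x y xS yS xy) eqxx orbF.
Qed.

End OrderComplex.

(** Inserting or deleting a fixed [v] in [F] outside [T] pairs sets of opposite sign. *)
Lemma alt_sum_interval (V : finType) (T F : {set V}) : T \proper F ->
  \sum_(G : {set V} | (T \subset G) && (G \subset F)) (-1) ^+ #|G| = 0 :> int.
Proof.
case/properP=> TF [v vF vT].
rewrite (bigID (fun G : {set V} => v \in G)) /=.
rewrite (reindex_onto (fun G => v |: G) (fun G => G :\ v)) /=; last first.
  by move=> G /andP[_ vG]; rewrite setD1K.
rewrite (eq_bigl (fun G : {set V} =>
    (T \subset G) && (G \subset F) && (v \notin G))); last first.
  move=> G; rewrite setU11 andbT subUset sub1set vF /=.
  case: (boolP (v \in G)) => vG /=.
    rewrite andbF; apply/negbTE/nandP; right; apply/eqP => /setP/(_ v).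
    by rewrite !inE eqxx vG.
  rewrite setU1K // eqxx !andbT; congr (_ && _).
  by rewrite -subDset (setDidPl _) // disjoint_sym disjoints1.
rewrite -big_split big1 //= => G /andP[_ vG].
by rewrite cardsU1 vG exprS mulN1r addNr.
Qed.

(** The hypotheses on [Q] are chosen to survive the induction: they pass both to [Q :\ F] with [F]
    of maximal cardinality and to the open interval between [T] and [F]. *)
Lemma alt_sum_order_complex_above (V : finType) (T : {set V})
    (Q : {set {set V}}) :
  {in Q, forall F : {set V}, T \proper F} ->
  (forall F G : {set V}, F \in Q -> T \proper G -> G \subset F -> G \in Q) ->
  alt_sum (order_complex Q) = (-1) ^+ #|T| * (\sum_(G in T |: Q) (-1) ^+ #|G|).
Proof.
have [n] := ubnP #|Q|; elim: n Q => // n IHn Q ltQn QT QS.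
have sign_sq m : (-1) ^+ m * (-1) ^+ m = 1 :> int by rewrite -expr2 sqrr_sign.
have TQ : T \notin Q by apply/negP => /QT; rewrite properxx.
have [Q0|[F0 F0Q]] := set_0Vmem Q.
  by rewrite Q0 setU0 big_set1 sign_sq alt_sum_order_complex0.
have [F FQ Fmax] :
    exists2 F : {set V}, F \in Q & {in Q, forall G : {set V}, #|G| <= #|F|}%N.
  by case: (arg_maxnP (fun F : {set V} => #|F|) F0Q) => F; exists F.
have TF := QT F FQ.
have ltQ1 : (#|Q :\ F| < n)%N by rewrite (cardsD1 F) FQ in ltQn.
set I := [set y in Q :\ F | (F >=< y)%O].
(* By maximality nothing in [Q] lies strictly above [F], so the elements comparable to [F] fill the
   open interval. *)
have inI G : (G \in I) = (T \proper G) && (G \proper F).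
  rewrite !inE; apply/andP/andP.
    case=> /andP[GF GQ]; rewrite /Order.comparable !leEface => FG.
    rewrite (QT _ GQ); split=> //.
    rewrite properEneq GF /=; case/orP: FG => // FG.
    by move: GF; rewrite eq_sym eqEcard FG Fmax.
  case=> TG; rewrite properEneq => /andP[GF sGF].
  by rewrite GF (QS _ _ FQ) // /Order.comparable !leEface sGF orbT.
rewrite (alt_sum_order_complexD1 FQ) IHn //; first last.
- move=> G H /setD1P[GF GQ] TH HG; rewrite in_setD1 (QS _ _ GQ) // andbT.
  apply: contraNneq GF => HF; rewrite eq_sym eqEcard -{1}HF HG.
  exact: Fmax.
- by move=> G /setD1P[_ /QT].
rewrite -/I (IHn I); first last.
- move=> G H; rewrite !inI => /andP[_ GF] -> HG /=.
  exact: sub_proper_trans HG GF.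
- by move=> G; rewrite inI => /andP[].
- apply: leq_ltn_trans ltQ1; apply/subset_leq_card/subsetP => G.
  by rewrite inE => /andP[].
(* [T |: I] is the closed interval without its top [F], and the closed interval sums to zero. *)
have -> : \sum_(G in T |: I) (-1) ^+ #|G| = - (-1) ^+ #|F| :> int.
  apply/eqP; rewrite -addr_eq0 addrC; apply/eqP.
  apply: etrans (alt_sum_interval TF); rewrite [RHS](bigD1 F) /=; last first.
    by rewrite (proper_sub TF) subxx.
  congr (_ + _); apply: eq_bigl => G; rewrite in_setU1 inI.
  case: (eqVneq G T) => [->|GT] /=.
    by rewrite subxx (proper_sub TF) (proper_neq TF).
  by rewrite !properEneq (eq_sym T) GT /= [(G != F) && _]andbC andbA.
rewrite (big_setU1 _ TQ) /= (big_setD1 F FQ) /= big_setU1 /=; last first.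
  by rewrite !inE (negPf TQ) andbF.
ring.
Qed.

(** The map sending [G] to [T :|: G] is a bijection from the link to the faces containing [T]; it
    multiplies signs by [(-1) ^+ #|T|], which the factor in [alt_sum_order_complex_above]
    cancels. *)
Lemma alt_sum_link (V : finType) (W : {set V}) (D : {set {set V}})
    (T : {set V}) :
  simplicial_complex W D -> T \in D ->
  alt_sum (link D T) =
  alt_sum (order_complex [set F in D | T \proper F]).
Proof.
move=> [_ _ _ DS] TD; rewrite (@alt_sum_order_complex_above _ T); first last.
- move=> F G; rewrite !inE => /andP[FD _] TG GF.
  by rewrite (DS _ _ GF FD).
- by move=> F; rewrite inE => /andP[].
rewrite /alt_sum mulr_sumr.
rewrite [RHS](reindex_onto (fun G => T :|: G) (fun G => G :\: T)) /=; last first.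
  move=> G; rewrite in_setU1 inE => GT; apply/eqP; rewrite setUC eqEsubset.
  rewrite setDE setUIl [~: T :|: T]setUC setUCr setIT.
  rewrite subUset subxx subsetUl /= andbT.
  by case/predU1P: GT => [->|/andP[_ /proper_sub]].
(* The side condition of the reindexing is exactly the disjointness clause of [link]. *)
have tG (G : {set V}) :
    ((T :|: G) :\: T == G) = (T :&: G == set0).
  rewrite setDUl setDv set0U setIC setI_eq0.
  by apply/eqP/idP => [/setDidPl|/setDidPl].
apply: eq_big => [G|G].
  rewrite tG [in LHS]inE andbA; congr (_ && _).
  rewrite in_setU1 inE properE subsetUl /=.
  have [TG|/negPf TG] := boolP (T :|: G \subset T).
    rewrite andbF orbF; have TGT : T :|: G = T.
      by apply/eqP; rewrite eqEsubset TG subsetUl.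
    by rewrite TGT eqxx TD andbT (DS _ _ _ TD) // -TGT subsetUr.
  have -> : (T :|: G == T) = false.
    by apply: contraFF TG => /eqP->.
  rewrite andbT /=; have [DG|] := boolP (T :|: G \in D); rewrite ?andbF //.
  by rewrite andbT (DS _ _ (subsetUr T G) DG).
rewrite inE => /and3P[_ _ /eqP TG0].
by rewrite cardsU TG0 cards0 subn0 exprD mulrA -expr2 sqrr_sign mul1r.
Qed.

Theorem theorem1p6 (V : finType) (W : {set V}) (Delta : {set {set V}})
    (complexDelta : simplicial_complex W Delta) (pureDelta : pure Delta)
    (k : nat) :
  \sum_(T in Delta | #|T| == k) reduced_euler (link Delta T) =
  euler (order_complex (poset_gt Delta k%:Z)) -
  euler (order_complex (poset_gt Delta (k%:Z - 1))).
Proof.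
set Q := poset_gt Delta k%:Z; set Q' := poset_gt Delta (k%:Z - 1).
pose S := [set T in Delta | #|T| == k].
have QE F : (F \in Q) = (F \in Delta) && (k < #|F|)%N by rewrite inE.
(* For [k = 0] the integer bound is [-1], so the empty face does enter [Q']. *)
have Q'E : Q' = Q :|: S.
  apply/setP => F; rewrite !inE -andb_orr; congr (_ && _); lia.
have dQS : [disjoint Q & S].
  rewrite -setI_eq0; apply/eqP/setP => F; rewrite !inE; lia.
have aS : {in S &, forall F G, (F >=< G)%O -> F = G}.
  move=> F G; rewrite !inE => /andP[_ /eqP cF] /andP[_ /eqP cG].
  rewrite /Order.comparable !leEface => /orP[] FG; apply/eqP.
    by rewrite eqEcard FG cF cG /=.
  by rewrite eq_sym eqEcard FG cF cG /=.
have oc0 R : set0 \in order_complex (R : {set {set V}}).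
  by case: (order_complex_complex R).
(* The two constants [- 1] cancel in the difference. *)
have -> : euler (order_complex Q) - euler (order_complex Q') =
    reduced_euler (order_complex Q) - reduced_euler (order_complex Q').
  by rewrite /reduced_euler; ring.
rewrite !reduced_eulerE // Q'E (alt_sum_order_complexU dQS aS).
rewrite opprK addrC addrAC subrr add0r -sumrN.
apply: eq_big => [T|T /andP[TD /eqP cT]]; first by rewrite inE.
rewrite reduced_eulerE; last first.
  by case: (link_complex complexDelta TD).
rewrite (alt_sum_link complexDelta TD); congr (- alt_sum (order_complex _)).
(* A face with more than [k] vertices is too large to lie inside [T], so comparability with [T]
   means strict containment of [T]. *)
apply/setP => F; rewrite [in LHS]inE [in RHS]inE QE.
case: (F \in Delta) => //=; rewrite /Order.comparable !leEface.
apply/idP/andP => [TF|[kF /orP[TF|FT]]].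
- by rewrite -cT proper_card // (proper_sub TF).
- by rewrite properEcard TF cT.
- by have := subset_leq_card FT; rewrite cT leqNgt kF.
Qed.
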